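(* Let $\mathbf B$ be a real $3\times 3$ matrix and let $\Delta: M_2(\mathbb{C})\to M_2(\mathbb{C})\otimes M_2(\mathbb{C})$ be the linear map given by $$\Delta(w_0\mathbf 1+\mathbf w\sigma)=w_0\,\mathbf 1\otimes \mathbf 1+\mathbf B\mathbf w\cdot\sigma\otimes \mathbf 1+\mathbf 1\otimes \mathbf B\mathbf w\cdot\sigma,\qquad w_0\in\mathbb{C},\ \mathbf w\in\mathbb{C}^3.$$ Then the following statements hold: (i) $\Delta$ is a quasi quantum quadratic operator if and only if $\Delta$ is positive, i.e. if and only if $\|\mathbf B\|\le 1/2$. (ii) $\Delta$ is $q$-pure if and only if $2\mathbf B$ is an isometry. Moreover, in this case $\Delta$ is positive.
   Context: $\mathbf 1$ is the $2\times 2$ identity matrix and $\sigma_1=\begin{pmatrix}0&1\\1&0\end{pmatrix}$, $\sigma_2=\begin{pmatrix}0&-i\\i&0\end{pmatrix}$, $\sigma_3=\begin{pmatrix}1&0\\0&-1\end{pmatrix}$ are the Pauli matrices; every $x\in M_2(\mathbb{C})$ is uniquely $x=w_0\mathbf 1+\mathbf w\sigma$, where $\mathbf w\sigma=\mathbf w\cdot\sigma=w_1\sigma_1+w_2\sigma_2+w_3\sigma_3$ for $\mathbf w=(w_1,w_2,w_3)\in\mathbb{C}^3$. $\|\mathbf B\|$ is the operator norm with respect to the Euclidean norm; ''isometry'' means isometry for the Euclidean norm on $\mathbb{R}^3$. For a linear map $\Delta: M_2(\mathbb{C})\to M_2(\mathbb{C})\otimes M_2(\mathbb{C})$ and a linear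 functional $\varphi$ on $M_2(\mathbb{C})$, define $V_\Delta(\varphi)=(\varphi\otimes\varphi)\circ\Delta$. A functional $\varphi$ is positive if $\varphi(x)\ge0$ whenever $x\ge0$ (positive semidefinite), and a state if moreover $\varphi(\mathbf 1)=1$. $\Delta$ is positive if $\Delta(x)\ge 0$ whenever $x\ge 0$. $\Delta$ is a quasi quantum quadratic operator if it is linear, unital ($\Delta(\mathbf 1)=\mathbf 1\otimes \mathbf 1$), $*$-preserving ($\Delta(x^* )=\Delta(x)^*$), and $V_\Delta(\varphi)$ is a positive functional whenever $\varphi$ is. A quasi quantum quadratic operator $\Delta$ is $q$-pure if $V_\Delta(\varphi)$ is a pure state for every pure state $\varphi$. States $\varphi$ on $M_2(\mathbb{C})$ correspond bijectively to vectors $\mathbf f\in\mathbb{R}^3$ with $\|\mathbf f\|\le1$ via $\varphi(w_0\mathbf 1+\mathbf w\sigma)=w_0+\langle\mathbf w,\mathbf f\rangle$, and $\varphi$ is pure iff $\|\mathbf f\|=1$. *)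

(* Defs.v *)
From HB Require Import structures.
From mathcomp Require Import all_boot all_order all_algebra.
From mathcomp Require Import complex mxtens.
From mathcomp Require Import boolp classical_sets reals.

Set Implicit Arguments.
Unset Strict Implicit.
Unset Printing Implicit Defensive.

Import Order.TTheory GRing.Theory Num.Theory.

Local Open Scope classical_set_scope.
Local Open Scope ring_scope.

Section Pauli.
Variable R : realType.
Local Notation C := R[i].

Definition mx22 (a b c d : C) : 'M[C]_2 :=
  \matrix_(i, j) if i == 0 then (if j == 0 then a else b)
                 else (if j == 0 then c else d).

Definition sigma1 : 'M[C]_2 := mx22 0 1 1 0.
Definition sigma2 : 'M[C]_2 := mx22 0 (- 'i%C) 'i%C 0.
Definition sigma3 : 'M[C]_2 := mx22 1 0 0 (- 1).

Definition dot_sigma (w : 'cV[C]_3) : 'M[C]_2 :=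
  w 0 0 *: sigma1 + w 1 0 *: sigma2 + w 2 0 *: sigma3.

End Pauli.

Section Euclidean.
Variable R : realType.

(* MathComp-Analysis's norm on matrices is the sup norm, hence these. *)
Definition enorm n (v : 'cV[R]_n) : R := Num.sqrt (\sum_i v i 0 ^+ 2).

Definition opnorm n (A : 'M[R]_n) : R :=
  sup [set enorm (A *m v) | v in [set v : 'cV[R]_n | enorm v <= 1]].

Definition mx_isometry n (A : 'M[R]_n) : Prop :=
  forall u v : 'cV[R]_n, enorm (A *m u - A *m v) = enorm (u - v).

End Euclidean.

Section Operators.
Variable R : realType.
Local Notation C := R[i].

Definition adjmx m n (A : 'M[C]_(m, n)) : 'M[C]_(n, m) := map_mx Num.conj A^T.

(* The order of R[i] makes [0 <= z] mean that z is real and nonnegative, so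
   that this implies that A is self-adjoint. *)
Definition psdmx n (A : 'M[C]_n) : Prop :=
  forall v : 'cV[C]_n, 0 <= (adjmx v *m A *m v) 0 0.

Definition positive_functional n (phi : 'M[C]_n -> C) : Prop :=
  forall x, psdmx x -> 0 <= phi x.

Definition state n (phi : {scalar 'M[C]_n}) : Prop :=
  positive_functional phi /\ phi 1%:M = 1.

Definition pure_state n (phi : {scalar 'M[C]_n}) : Prop :=
  state phi /\
  forall (psi1 psi2 : {scalar 'M[C]_n}) (t : R),
    state psi1 -> state psi2 -> 0 < t < 1 ->
    (forall x, phi x = t%:C%C * psi1 x + (1 - t)%:C%C * psi2 x) ->
    psi1 =1 phi /\ psi2 =1 phi.

Section TensorFunctional.
Variables (m n : nat) (phi : {scalar 'M[C]_m}) (psi : {scalar 'M[C]_n}).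

(* M_m (x) M_n is identified with M_(m * n) by the Kronecker product [*t], so
   the coefficient of E_ij (x) E_kl in x sits at ((i, k), (j, l)). *)
Definition tens_functional (x : 'M[C]_(m * n)) : C :=
  \sum_i \sum_j \sum_k \sum_l
    x (mxtens_index (i, k)) (mxtens_index (j, l)) *
    (phi (delta_mx i j) * psi (delta_mx k l)).

Fact tens_functional_is_scalar : scalar tens_functional.
Proof.
move=> a x y; rewrite /tens_functional mulr_sumr -big_split /=.
apply: eq_bigr => i _; rewrite mulr_sumr -big_split /=.
apply: eq_bigr => j _; rewrite mulr_sumr -big_split /=.
apply: eq_bigr => k _; rewrite mulr_sumr -big_split /=.
by apply: eq_bigr => l _; rewrite !mxE mulrDl !mulrA.
Qed.
HB.instance Definition _ := GRing.isLinear.Build C 'M[C]_(m * n) C *%R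
  tens_functional tens_functional_is_scalar.

Lemma tens_functionalE (x : 'M[C]_m) (y : 'M[C]_n) :
  tens_functional (x *t y) = phi x * psi y.
Proof.
rewrite [in RHS](matrix_sum_delta x) [in RHS](matrix_sum_delta y).
rewrite !linear_sum mulr_suml; apply: eq_bigr => i _.
rewrite linear_sum mulr_suml; apply: eq_bigr => j _.
rewrite mulr_sumr; apply: eq_bigr => k _.
rewrite linear_sum mulr_sumr; apply: eq_bigr => l _.
by rewrite tensmxE !linearZ /= mulrACA.
Qed.

End TensorFunctional.

Section QuasiQuadratic.
Variable Delta : {linear 'M[C]_2 -> 'M[C]_(2 * 2)}.

Definition quad_functional (phi : {scalar 'M[C]_2}) : {scalar 'M[C]_2} :=
  tens_functional phi phi \o Delta.

Definition positive_map : Prop := forall x, psdmx x -> psdmx (Delta x).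

Definition quasi_qqo : Prop :=
  [/\ Delta 1%:M = 1%:M *t 1%:M,
      forall x, Delta (adjmx x) = adjmx (Delta x)
    & forall phi : {scalar 'M[C]_2},
        positive_functional phi -> positive_functional (quad_functional phi)].

Definition q_pure : Prop :=
  quasi_qqo /\
  forall phi : {scalar 'M[C]_2},
    pure_state phi -> pure_state (quad_functional phi).

End QuasiQuadratic.
End Operators.

(* Main.v *)
(* In Pauli coordinates both the positive elements [s 1 + u sigma] of M_2 and
   the positive functionals form the self-dual cone |u| <= s.  The quadratic
   map [V_Delta] sends the functional with coordinates (s, u) to the one with
   coordinates (s^2, 2 s B^T u), so that [Delta] is a quasi q.q.o. iff
   |B^T u| <= |u| / 2 for all u, iff |B v| <= |v| / 2 for all v.  In that case
   Delta(s 1 + u sigma) = P (x) 1 + 1 (x) P with P = s/2 1 + (B u) sigma >= 0;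
   conversely, testing positivity of Delta(|w| 1 + w sigma) on v (x) v, with v
   an eigenvector of (B w) sigma for - |B w|, gives |w| - 2 |B w| >= 0.
   Pure states are the unit vectors u, hence q-purity says that 2 B^T maps the
   unit sphere into itself. *)
Require Import Defs.
From HB Require Import structures.
From mathcomp Require Import all_boot all_order all_algebra.
From mathcomp Require Import complex mxtens.
From mathcomp Require Import boolp classical_sets reals.
From mathcomp Require Import ring lra.
Set Implicit Arguments.
Unset Strict Implicit.
Unset Printing Implicit Defensive.
Import Order.TTheory GRing.Theory Num.Theory.
Local Open Scope ring_scope.

(** * Bilinear dot product *)

(** Bilinear even over [R[i]], with no conjugation: a functional acts linearly on complex Pauli
    coordinates through a real vector. *)
Definition dotv (K : comNzRingType) n (u v : 'cV[K]_n) : K :=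
  \sum_i u i 0 * v i 0.

Section Dot.
Variable K : comNzRingType.

Lemma dotvC n (u v : 'cV[K]_n) : dotv u v = dotv v u.
Proof. by apply: eq_bigr => i _; rewrite mulrC. Qed.

Lemma dotvDr n (u v w : 'cV[K]_n) : dotv u (v + w) = dotv u v + dotv u w.
Proof. by rewrite -big_split; apply: eq_bigr => i _; rewrite mxE mulrDr. Qed.

Lemma dotvZr n a (u v : 'cV[K]_n) : dotv u (a *: v) = a * dotv u v.
Proof. by rewrite mulr_sumr; apply: eq_bigr => i _; rewrite mxE mulrCA. Qed.

Lemma dotvDl n (u v w : 'cV[K]_n) : dotv (u + v) w = dotv u w + dotv v w.
Proof. by rewrite dotvC dotvDr !(dotvC w). Qed.

Lemma dotvZl n a (u v : 'cV[K]_n) : dotv (a *: u) v = a * dotv u v.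
Proof. by rewrite dotvC dotvZr dotvC. Qed.

Lemma dotv_mulmx m n (A : 'M[K]_(m, n)) u v :
  dotv u (A *m v) = dotv (A^T *m u) v.
Proof.
have dotvE p (x y : 'cV[K]_p) : dotv x y = (x^T *m y) 0 0.
  by rewrite mxE; apply: eq_bigr => i _; rewrite mxE.
by rewrite !dotvE trmx_mul trmxK mulmxA.
Qed.

Lemma dotv_delta n i (u : 'cV[K]_n) : dotv (delta_mx i 0) u = u i 0.
Proof.
rewrite /dotv (bigD1 i) //= mxE !eqxx mul1r big1 ?addr0 // => j /negbTE nij.
by rewrite mxE nij mul0r.
Qed.

End Dot.

(** * Euclidean norm, operator norm and isometries *)

Section Euclid.
Variable R : realType.

Lemma enorm_ge0 n (u : 'cV[R]_n) : 0 <= enorm u.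
Proof. exact: sqrtr_ge0. Qed.

Lemma sqr_enorm n (u : 'cV[R]_n) : enorm u ^+ 2 = dotv u u.
Proof. by rewrite sqr_sqrtr // sumr_ge0 // => i _; rewrite sqr_ge0. Qed.

Lemma enormE n (u : 'cV[R]_n) : enorm u = Num.sqrt (dotv u u).
Proof. by []. Qed.

Lemma enormZ n a (u : 'cV[R]_n) : enorm (a *: u) = `|a| * enorm u.
Proof.
by rewrite !enormE dotvZl dotvZr mulrA -expr2 sqrtrM ?sqr_ge0 // sqrtr_sqr.
Qed.

Lemma enorm0_eq0 n (u : 'cV[R]_n) : enorm u = 0 -> u = 0.
Proof.
move=> u0; have /eqP := sqr_enorm u; rewrite u0 expr0n /= eq_sym /dotv.
rewrite psumr_eq0 => [/allP z|i _]; last by rewrite -expr2 sqr_ge0.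
apply/matrixP => i j; rewrite ord1 mxE; apply/eqP.
by have := z i (mem_index_enum _); rewrite mulf_eq0 orbb.
Qed.

(** Cauchy-Schwarz, by expanding the squared norm of |v| u - |u| v. The bound is one-sided; applying
    it to [-1 *: u] gives the other side. *)
Lemma dotv_le n (u v : 'cV[R]_n) : dotv u v <= enorm u * enorm v.
Proof.
have [u0|u0] := eqVneq (enorm u) 0.
  by rewrite u0 (enorm0_eq0 u0) mul0r /dotv big1 // => i _; rewrite mxE mul0r.
have [v0|v0] := eqVneq (enorm v) 0.
  by rewrite v0 (enorm0_eq0 v0) mulr0 /dotv big1 // => i _; rewrite mxE mulr0.
have := sqr_ge0 (enorm (enorm v *: u + - enorm u *: v)).
rewrite sqr_enorm !dotvDl !dotvDr !dotvZl !dotvZr -!sqr_enorm (dotvC v u).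
set a := enorm u; set b := enorm v; set d := dotv u v => h.
have ab : 0 < a * b by rewrite mulr_gt0 // lt_def ?u0 ?v0 enorm_ge0.
rewrite -(ler_pM2l ab) -subr_ge0; lra.
Qed.

Lemma enormD n (u v : 'cV[R]_n) : enorm (u + v) <= enorm u + enorm v.
Proof.
rewrite -(ler_pXn2r (isT : (0 < 2)%N)) ?nnegrE ?addr_ge0 ?enorm_ge0 //.
rewrite sqr_enorm dotvDl !dotvDr -!sqr_enorm (dotvC v u).
by have := dotv_le u v; nra.
Qed.

Lemma enorm_delta n i : enorm (delta_mx i 0 : 'cV[R]_n) = 1.
Proof. by rewrite enormE dotv_delta mxE !eqxx sqrtr1. Qed.

Lemma opnorm_le n (A : 'M[R]_n) (c : R) : 0 <= c ->
  opnorm A <= c <-> forall v, enorm (A *m v) <= c * enorm v.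
Proof.
move=> c0; have norm0 : enorm (0 : 'cV[R]_n) = 0.
  by rewrite -(scale0r 0) enormZ normr0 mul0r.
split=> [h v|h]; last first.
  apply: ge_sup; first by exists (enorm (A *m 0)), 0 => //=; rewrite norm0.
  by move=> _ [v /= v1 <-]; apply: (le_trans (h v)); rewrite ler_piMr.
have [v0|v0] := eqVneq (enorm v) 0.
  by rewrite (enorm0_eq0 v0) mulmx0 norm0 mulr0.
have vp : 0 < enorm v by rewrite lt_def v0 enorm_ge0.
have hs : has_sup
    [set enorm (A *m v) | v in [set v : 'cV[R]_n | enorm v <= 1]]%classic.
  split; first by exists (enorm (A *m 0)), 0 => //=; rewrite norm0.
  (* Cauchy-Schwarz on each row bounds |A w|^2 by the sum S of the squared row norms, and x^2 <= S
     implies x <= 1 + S, which avoids a square root. *)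
  exists (1 + \sum_i enorm (row i A)^T ^+ 2) => _ [w /= w1 <-].
  have S0 : 0 <= \sum_i enorm (row i A)^T ^+ 2.
    by rewrite sumr_ge0 // => i _; rewrite sqr_ge0.
  have : enorm (A *m w) ^+ 2 <= \sum_i enorm (row i A)^T ^+ 2.
    rewrite sqr_enorm /dotv; apply: ler_sum => i _.
    have -> : (A *m w) i 0 = dotv (row i A)^T w.
      by rewrite mxE; apply: eq_bigr => j _; rewrite !mxE.
    have h1 := dotv_le (row i A)^T w; have h2 := dotv_le (row i A)^T (-1 *: w).
    rewrite dotvZr enormZ normrN1 mul1r in h2.
    have h3 : enorm (row i A)^T * enorm w <= enorm (row i A)^T.
      by rewrite ler_piMr ?enorm_ge0.
    by nra.
  by nra.
have : enorm (A *m ((enorm v)^-1 *: v)) <= c.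
  apply: le_trans h; apply: ub_le_sup; first exact: hs.2.
  exists ((enorm v)^-1 *: v); last by [].
  by rewrite /= enormZ ger0_norm ?invr_ge0 ?(ltW vp) ?mulVf ?lexx.
rewrite -scalemxAr enormZ ger0_norm ?invr_ge0 ?(ltW vp) //.
by rewrite ler_pdivrMl // mulrC.
Qed.

(** Polarization recovers dot products from norms; the entries are then read off on basis
    vectors. *)
Lemma mx_isometryE n (A : 'M[R]_n) : mx_isometry A <-> A^T *m A = 1%:M.
Proof.
split=> [h|h u v]; last first.
  by rewrite -mulmxBr !enormE dotv_mulmx mulmxA h mul1mx.
have hn u : dotv (A *m u) (A *m u) = dotv u u.
  by have := h u 0; rewrite mulmx0 !subr0 -!sqr_enorm => ->.
have hd u v : dotv (A *m u) (A *m v) = dotv u v.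
  have := hn (u + v); rewrite mulmxDr !dotvDl !dotvDr !hn.
  rewrite (dotvC v u) (dotvC (A *m v)); lra.
apply/matrixP => i j.
have := hd (delta_mx j 0) (delta_mx i 0).
rewrite dotv_mulmx mulmxA dotvC dotv_delta -colE mxE => ->.
by rewrite dotv_delta !mxE eqxx andbT eq_sym.
Qed.

(** |A^T u|^2 = <u, A A^T u> <= |u| c |A^T u|; divide by |A^T u|. This passes between [B] and the
    matrix [B^T] acting on functionals. *)
Lemma contraction_trmx m n (c : R) (A : 'M[R]_(m, n)) : 0 <= c ->
  (forall v, enorm (A *m v) <= c * enorm v) ->
  forall u, enorm (A^T *m u) <= c * enorm u.
Proof.
move=> c0 h u; have := h (A^T *m u); have := dotv_le u (A *m (A^T *m u)).
rewrite dotv_mulmx -sqr_enorm; have := enorm_ge0 u.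
have [-> *|v0] := eqVneq (enorm (A^T *m u)) 0; first exact: mulr_ge0.
have vp : 0 < enorm (A^T *m u) by rewrite lt_def v0 enorm_ge0.
move=> u0 h1 h2; rewrite -(ler_pM2l vp).
have := ler_wpM2l u0 h2; nra.
Qed.

Lemma unit_isometry n (A : 'M[R]_n) :
  (forall u, enorm u = 1 -> enorm (A *m u) = 1) -> mx_isometry A.
Proof.
move=> h u v; rewrite -mulmxBr; move: (u - v) => {u v}w.
have [w0|w0] := eqVneq (enorm w) 0; first by rewrite (enorm0_eq0 w0) mulmx0.
have wp : 0 < (enorm w)^-1 by rewrite invr_gt0 lt_def w0 enorm_ge0.
have := h ((enorm w)^-1 *: w); rewrite -scalemxAr !enormZ gtr0_norm // mulVf //.
by move=> /(_ erefl) /(canRL (mulKf _)) ->; rewrite ?invr_eq0 // invrK mulr1.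
Qed.

Lemma mx_isometry_norm n (A : 'M[R]_n) u : mx_isometry A ->
  enorm (A *m u) = enorm u.
Proof. by move/(_ u 0); rewrite mulmx0 !subr0. Qed.

Lemma mx_isometry_trmx n (A : 'M[R]_n) : mx_isometry A^T <-> mx_isometry A.
Proof. by rewrite !mx_isometryE trmxK; split=> /mulmx1C. Qed.

End Euclid.

Lemma sum_ord2 (V : nmodType) (F : 'I_2 -> V) : \sum_i F i = F 0 + F 1.
Proof. by rewrite big_ord_recl big_ord1; congr (_ + F _); apply: val_inj. Qed.

Lemma sum_ord3 (V : nmodType) (F : 'I_3 -> V) : \sum_i F i = F 0 + F 1 + F 2.
Proof.
by rewrite big_ord_recl sum_ord2 addrA; congr (_ + F _ + F _); apply: val_inj.
Qed.

Lemma mxtrace_tens (K : comNzRingType) m n (A : 'M[K]_m) (B : 'M[K]_n) :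
  \tr (A *t B) = \tr A * \tr B.
Proof.
rewrite mulr_sum; apply: eq_bigr => k _.
by rewrite !mxE.
Qed.

(** * Pauli coordinates and the cone |u| <= s *)

Section Pauli.
Variable R : realType.
Local Notation C := R[i].
Local Notation toC := (map_mx (real_complex R)).

Lemma dotv_toC n (u v : 'cV[R]_n) : dotv (toC u) (toC v) = (dotv u v)%:C%C.
Proof.
by rewrite /dotv rmorph_sum; apply: eq_bigr => i _; rewrite rmorphM !mxE.
Qed.

Lemma conj_toC (t : R) : (t%:C%C : C)^* = t%:C%C.
Proof. by congr Complex; rewrite oppr0. Qed.

(* The cone {|u| <= s} is self-dual; positivity of elements of M_2 and of
   functionals on M_2 both reduce to this. *)
Lemma cone_dual n (a0 : C) (a : 'cV[C]_n.+1) :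
  (forall f : 'cV[R]_n.+1, 0 <= (enorm f)%:C%C * a0 + dotv (toC f) a) <->
  exists s u, [/\ a0 = s%:C%C, a = toC u & enorm u <= s].
Proof.
split=> [h|[s [u [-> -> us]]] f]; last first.
  rewrite dotv_toC -rmorphM -rmorphD ler0c.
  have := dotv_le (-1 *: f) u; rewrite dotvZl enormZ normrN1 mul1r.
  by have := enorm_ge0 f; nra.
(* Testing on plus and minus the basis vectors forces [a0] and every [a i 0] to be real. The
   dimension is [n.+1] so that an index 0 exists for [a0]. *)
have hi i : 0 <= a0 + a i 0 /\ 0 <= a0 - a i 0.
  have := h (-1 *: delta_mx i 0); have := h (delta_mx i 0).
  rewrite enormZ enorm_delta normrN1 mul1r map_mxZ map_delta_mx.
  by rewrite dotvZl dotv_delta rmorphN !rmorph1 !mul1r mulN1r.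
have im0 : complex.Im a0 = 0.
  have [] := hi 0; rewrite !lecE; case: (a0) (a 0 0) => [? ?] [? ?] /=.
  by move=> /andP[/eqP h1 _] /andP[/eqP h2 _]; lra.
have a0E : a0 = (complex.Re a0)%:C%C by case: (a0) im0 => ? ? /= ->.
have aE : a = toC (map_mx (@complex.Re R) a).
  apply/matrixP => i j; rewrite ord1 !mxE.
  have [] := hi i; rewrite !lecE a0E; case: (a i 0) => [x y] /=.
  by move=> /andP[/eqP h1 _] _; congr Complex; lra.
exists (complex.Re a0), (map_mx (@complex.Re R) a); split=> //.
set u := map_mx _ _.
(* The test vector -u yields |u| (s - |u|) >= 0. If u = 0 this is void, and s >= 0 comes from
   [hi]. *)
have := h (-1 *: u); rewrite a0E aE dotv_toC dotvZl -sqr_enorm enormZ.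
rewrite normrN1 mul1r -rmorphM -rmorphD ler0c -/u.
have [-> _|u0] := eqVneq (enorm u) 0.
  by have [] := hi 0; rewrite !lecE => /andP[_ /=] + /andP[_ /=];
     case: (a0) (a 0 0) => [? ?] [? ?] /=; lra.
have up : 0 < enorm u by rewrite lt_def u0 enorm_ge0.
by move=> ?; rewrite -(ler_pM2l up); lra.
Qed.

Lemma pauliE (a : C) (w : 'cV[C]_3) :
  a *: 1%:M + dot_sigma w =
  mx22 (a + w 2 0) (w 0 0 - 'i%C * w 1 0) (w 0 0 + 'i%C * w 1 0) (a - w 2 0).
Proof.
apply/matrixP => i j; rewrite !mxE.
by case: i j => [[|[|//]] ?] [[|[|//]] ?] /=; ring.
Qed.

Lemma mx22_eta (x : 'M[C]_2) : x = mx22 (x 0 0) (x 0 1) (x 1 0) (x 1 1).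
Proof.
by apply/matrixP => -[[|[|//]] ?] [[|[|//]] ?]; rewrite !mxE;
  congr (x _ _); apply: val_inj.
Qed.

Lemma pauli_decomp (x : 'M[C]_2) : exists a w, x = a *: 1%:M + dot_sigma w.
Proof.
(* The coordinates are the half traces of x sigma_k. *)
pose w : 'cV[C]_3 := \col_i if i == 0 then (x 0 1 + x 1 0) / 2
  else if i == 1 then 'i%C * (x 0 1 - x 1 0) / 2 else (x 0 0 - x 1 1) / 2.
exists ((x 0 0 + x 1 1) / 2), w; rewrite pauliE !mxE /= [LHS]mx22_eta.
by congr mx22; field: (@sqr_i R).
Qed.

Lemma dot_sigmaD (u v : 'cV[C]_3) :
  dot_sigma (u + v) = dot_sigma u + dot_sigma v.
Proof. by rewrite /dot_sigma !mxE !scalerDl (AC (2*2*2) (1*3*5*(2*4*6))). Qed.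

Lemma dot_sigmaZ a (u : 'cV[C]_3) : dot_sigma (a *: u) = a *: dot_sigma u.
Proof. by rewrite /dot_sigma !mxE !scalerDr !scalerA. Qed.

Lemma dot_sigma0 : dot_sigma 0 = 0 :> 'M[C]_2.
Proof. by rewrite -(scale0r 0) dot_sigmaZ scale0r. Qed.

Lemma dot_sigma_sum (w : 'cV[C]_3) :
  dot_sigma w = \sum_k w k 0 *: dot_sigma (delta_mx k 0).
Proof.
rewrite [in LHS](matrix_sum_delta w) (big_morph _ dot_sigmaD dot_sigma0).
by apply: eq_bigr => k _; rewrite big_ord1 dot_sigmaZ.
Qed.

(** The identity and the Pauli matrices are orthogonal for the trace form, each of square trace
    2. *)
Lemma mxtrace_pauli (a b : C) (u w : 'cV[C]_3) :
  \tr ((a *: 1%:M + dot_sigma u) *m (b *: 1%:M + dot_sigma w)) =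
  2 * (a * b + dotv u w).
Proof.
rewrite !pauliE /dotv sum_ord3 /mxtrace sum_ord2 !mxE !sum_ord2 !mxE /=.
ring: (@sqr_i R).
Qed.

(** * Adjoints and positive semidefinite matrices *)

Lemma adjmx_mul m n p (A : 'M[C]_(m, n)) (B : 'M[C]_(n, p)) :
  adjmx (A *m B) = adjmx B *m adjmx A.
Proof. by rewrite /adjmx trmx_mul map_mxM. Qed.

Lemma adjmxD m n (A B : 'M[C]_(m, n)) : adjmx (A + B) = adjmx A + adjmx B.
Proof. by rewrite /adjmx linearD map_mxD. Qed.

Lemma adjmxZ m n a (A : 'M[C]_(m, n)) : adjmx (a *: A) = a^* *: adjmx A.
Proof. by rewrite /adjmx linearZ map_mxZ. Qed.

Lemma adjmx_tens m n p q (A : 'M[C]_(m, n)) (B : 'M[C]_(p, q)) :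
  adjmx (A *t B) = adjmx A *t adjmx B.
Proof. by rewrite /adjmx trmx_tens map_mxT. Qed.

Lemma adjmx1 n : adjmx 1%:M = 1%:M :> 'M[C]_n.
Proof. by rewrite /adjmx trmx1 map_mx1. Qed.

Lemma adjmx_pauli (a : C) (w : 'cV[C]_3) :
  adjmx (a *: 1%:M + dot_sigma w) =
  a^* *: 1%:M + dot_sigma (map_mx Num.conj w).
Proof.
rewrite !pauliE [LHS]mx22_eta !mxE /=.
have conji : ('i%C : C)^* = - 'i%C by congr Complex; rewrite oppr0.
by congr mx22; rewrite !(rmorphD, rmorphN, rmorphM) /= ?conji ?mulNr ?opprK.
Qed.

Lemma psdmxD n (A B : 'M[C]_n) : psdmx A -> psdmx B -> psdmx (A + B).
Proof.
by move=> hA hB v; rewrite mulmxDr mulmxDl mxE addr_ge0.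
Qed.

Lemma psdmx_gram m n (G : 'M[C]_(n, m)) : psdmx (G *m adjmx G).
Proof.
move=> v; rewrite !mulmxA -mulmxA.
have -> : adjmx G *m v = adjmx (adjmx v *m G).
  apply/matrixP => i j; rewrite adjmx_mul !mxE; apply: eq_bigr => k _.
  by rewrite !mxE conjCK.
rewrite mxE sumr_ge0 // => i _; rewrite !mxE -normCK.
by rewrite exprn_ge0.
Qed.

(** By cyclicity of the trace; in this form [mxtrace_pauli] applies once v v* is known in Pauli
    coordinates. *)
Lemma psdmxE n (A : 'M[C]_n) :
  psdmx A <-> forall v : 'cV[C]_n, 0 <= \tr (A *m (v *m adjmx v)).
Proof.
by split=> h v; have := h v;
  rewrite mulmxA mxtrace_mulC mulmxA /mxtrace big_ord1.
Qed.

(* [v] is an eigenvector of [f . sigma] for the eigenvalue [|f|], of squared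
   norm [|f|]. *)
Lemma spinor (f : 'cV[R]_3) : exists v : 'cV[C]_2,
  v *m adjmx v = 2^-1 *: ((enorm f)%:C%C *: 1%:M + dot_sigma (toC f)).
Proof.
have := sqr_enorm f; have := enorm_ge0 f; rewrite /dotv sum_ord3 pauliE !mxE.
set s := enorm f; move: (f 0 0) (f 1 0) (f 2 0) => x y z s0 sE.
have scaleE (a b c d k : C) :
    k *: mx22 a b c d = mx22 (k * a) (k * b) (k * c) (k * d).
  by rewrite [LHS]mx22_eta !mxE.
have outerE (a b : C) : let v := \col_i (if i == 0 then a else b) : 'cV[C]_2 in
    v *m adjmx v = mx22 (a * a^*) (a * b^*) (b * a^*) (b * b^*).
  by rewrite /= [LHS]mx22_eta !mxE !big_ord1 !mxE.
have half (t : R) : 2^-1 * t%:C%C = (t / 2)%:C%C :> C.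
  by rewrite mulrC rmorphM fmorphV rmorph_nat.
(* Here f = (0, 0, -s), where the generic spinor (r, (x + iy) / (2r)) with r^2 = (s + z) / 2 would
   divide by zero. *)
have [sz|sz] := eqVneq (s + z) 0.
  have x0 : x = 0 by nra.
  have y0 : y = 0 by nra.
  exists (\col_i (if i == 0 then 0 else (Num.sqrt s)%:C%C)).
  rewrite outerE scaleE x0 y0; congr mx22.
  - by rewrite mul0r -rmorphD half sz mul0r.
  - by rewrite mul0r rmorph0 mulr0 subr0 mulr0.
  - by rewrite !rmorph0 !mulr0 addr0 mulr0.
  - rewrite conj_toC -rmorphM -rmorphB half -expr2 sqr_sqrtr //.
    by congr (_%:C%C); lra.
have szp : 0 < s + z by rewrite lt_def sz; nra.
set r := Num.sqrt ((s + z) / 2).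
have r2 : r ^+ 2 = (s + z) / 2 by rewrite sqr_sqrtr // divr_ge0 // ltW.
have rp : 0 < r by rewrite sqrtr_gt0 divr_gt0.
exists (\col_i
  (if i == 0 then r%:C%C else Complex (x / (2 * r)) (y / (2 * r)))).
rewrite outerE scaleE; congr mx22; rewrite ?conj_toC.
- by rewrite -rmorphM -rmorphD half -expr2 r2.
- by apply/eqP; rewrite eq_complex /=; apply/andP; split; apply/eqP; field;
    rewrite gt_eqF.
- by apply/eqP; rewrite eq_complex /=; apply/andP; split; apply/eqP; field;
    rewrite gt_eqF.
rewrite -rmorphB half; apply/eqP; rewrite eq_complex /=.
apply/andP; split; apply/eqP; last by ring.
(* This is x^2 + y^2 = (s - z)(s + z), from s^2 = x^2 + y^2 + z^2. *)
have xy : x * x + y * y = (s - z) * (2 * r ^+ 2) by rewrite r2; lra.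
transitivity ((x * x + y * y) / (4 * r ^+ 2)); first by field; rewrite gt_eqF.
by rewrite xy; field; rewrite gt_eqF.
Qed.

(** Turns the quadratic form at a spinor into the pairing of [cone_dual]. *)
Lemma spinor_trace (f : 'cV[R]_3) : exists v : 'cV[C]_2, forall a w,
  \tr ((a *: 1%:M + dot_sigma w) *m (v *m adjmx v)) =
  (enorm f)%:C%C * a + dotv (toC f) w.
Proof.
have [v vE] := spinor f; exists v => a w.
rewrite vE -scalemxAr mxtraceZ mxtrace_pauli dotvC mulrC (mulrC a).
by rewrite mulrC mulrA mulVf ?mul1r // pnatr_eq0.
Qed.

(** Split the matrix as (s - |u|) 1 + (|u| 1 + u sigma). The second summand is 2 v v* for the spinor
    v, so G juxtaposes square roots of the two. *)
Lemma pauli_gram s (u : 'cV[R]_3) : enorm u <= s ->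
  exists m (G : 'M[C]_(2, m)),
    s%:C%C *: 1%:M + dot_sigma (toC u) = G *m adjmx G.
Proof.
move=> us; have [v vE] := spinor u.
pose G :=
  row_mx ((Num.sqrt (s - enorm u))%:C%C *: 1%:M) ((Num.sqrt 2)%:C%C *: v).
exists (2 + 1)%N, G.
rewrite /adjmx tr_row_mx map_col_mx mul_row_col -!/(adjmx _).
rewrite !adjmxZ adjmx1 !conj_toC -!scalemxAl -!scalemxAr mulmx1 vE !scalerA.
rewrite -!rmorphM -!expr2 !sqr_sqrtr ?subr_ge0 // rmorphB rmorph_nat /=.
by rewrite mulfV ?pnatr_eq0 // scale1r scalerBl [RHS]addrA subrK.
Qed.

Lemma psdmx_pauli (a : C) (w : 'cV[C]_3) :
  psdmx (a *: 1%:M + dot_sigma w) <->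
  exists s u, [/\ a = s%:C%C, w = toC u & enorm u <= s].
Proof.
split=> [/psdmxE h|[s [u [-> -> /pauli_gram[m [G ->]]]]]].
  by apply/cone_dual => f; have [v <-] := spinor_trace f.
exact: psdmx_gram.
Qed.

Lemma psdmx_gramP (A : 'M[C]_2) : psdmx A ->
  exists m (G : 'M[C]_(2, m)), A = G *m adjmx G.
Proof.
have [a [w ->]] := pauli_decomp A.
by move=> /psdmx_pauli[s [u [-> -> /pauli_gram]]].
Qed.

(** Gram factorizations multiply: GG* (x) HH* = (G (x) H)(G (x) H)*. *)
Lemma psdmx_tens (A B : 'M[C]_2) : psdmx A -> psdmx B -> psdmx (A *t B).
Proof.
move=> /psdmx_gramP[m [G ->]] /psdmx_gramP[n [H ->]].
by rewrite -tensmx_mul -adjmx_tens; apply: psdmx_gram.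
Qed.

Lemma psdmx1 : psdmx (1%:M : 'M[C]_2).
Proof. by have := psdmx_gram (1%:M : 'M[C]_2); rewrite adjmx1 mulmx1. Qed.

(* States have [s = 1]; general [s] covers all positive functionals, which
   [quasi_qqo] quantifies over. *)
Definition bloch (phi : 'M[C]_2 -> C) (s : R) (u : 'cV[R]_3) : Prop :=
  forall a w, phi (a *: 1%:M + dot_sigma w) = s%:C%C * a + dotv (toC u) w.

(** * Positive functionals, states and pure states in Bloch coordinates *)

(** Positivity on the elements |f| 1 + f sigma is exactly the hypothesis of [cone_dual]; the
    converse is Cauchy-Schwarz between two elements of the cone. *)
Lemma positive_functionalP (phi : {scalar 'M[C]_2}) :
  positive_functional phi <-> exists s u, bloch phi s u /\ enorm u <= s.
Proof.
split=> [h|[s [u [phiE us]]] x].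
  pose a := \col_k phi (dot_sigma (delta_mx k 0)) : 'cV[C]_3.
  have phiE b w : phi (b *: 1%:M + dot_sigma w) = phi 1%:M * b + dotv a w.
    rewrite dot_sigma_sum linearD linearZ linear_sum /= mulrC; congr (_ + _).
    by apply: eq_bigr => k _; rewrite mxE linearZ /= mulrC.
  have /cone_dual[s [u [e1 e2 us]]] : forall f : 'cV[R]_3,
      0 <= (enorm f)%:C%C * phi 1%:M + dotv (toC f) a.
    move=> f; rewrite mulrC dotvC -phiE; apply: h.
    by apply/psdmx_pauli; exists (enorm f), f.
  by exists s, u; split=> // b w; rewrite phiE e1 e2.
have [a [w ->]] := pauli_decomp x; move=> /psdmx_pauli[t [v [-> -> vt]]].
rewrite phiE dotv_toC -rmorphM -rmorphD ler0c.
have := dotv_le (-1 *: u) v; rewrite dotvZl enormZ normrN1 mul1r.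
by have := enorm_ge0 u; have := enorm_ge0 v; nra.
Qed.

Lemma bloch_inj phi s t u v : bloch phi s u -> bloch phi t v -> s = t /\ u = v.
Proof.
move=> hu hv; split.
  have := hu 1 0; rewrite hv -(scale0r 0) !dotvZr !mul0r !addr0 !mulr1.
  by move/(@complexI R).
apply/matrixP => i j; rewrite ord1.
have := hu 0 (delta_mx i 0); rewrite hv !mulr0 !add0r !(dotvC _ (delta_mx i 0)).
by rewrite !dotv_delta !mxE => /(@complexI R).
Qed.

Lemma bloch_eq phi psi s u : bloch phi s u -> bloch psi s u -> phi =1 psi.
Proof.
by move=> h1 h2 x; have [a [w ->]] := pauli_decomp x; rewrite h1 h2.
Qed.

(** The trace against the density matrix (s 1 + u sigma) / 2. *)
Definition bloch_functional (s : R) (u : 'cV[R]_3) (x : 'M[C]_2) : C :=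
  2^-1 * \tr (x *m (s%:C%C *: 1%:M + dot_sigma (toC u))).

Fact bloch_functional_is_scalar s u : scalar (bloch_functional s u).
Proof.
move=> a x y; rewrite /bloch_functional mulmxDl -scalemxAl mxtraceD mxtraceZ.
by rewrite mulrDr mulrCA.
Qed.
HB.instance Definition _ s u := GRing.isLinear.Build C 'M[C]_2 C *%R
  (bloch_functional s u) (bloch_functional_is_scalar s u).

Lemma bloch_functionalE s u : bloch (bloch_functional s u) s u.
Proof.
move=> a w; rewrite /bloch_functional mxtrace_pauli dotvC (mulrC a).
by rewrite mulrA mulVf ?mul1r // pnatr_eq0.
Qed.

Lemma bloch_unit phi s u : bloch phi s u -> phi 1%:M = s%:C%C.
Proof.
move/(_ 1 0); rewrite scale1r dot_sigma0 addr0 mulr1 -(scale0r 0).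
by rewrite dotvZr mul0r addr0.
Qed.

Lemma bloch_sigma phi s u w : bloch phi s u ->
  phi (dot_sigma w) = dotv (toC u) w.
Proof. by move/(_ 0 w); rewrite scale0r mulr0 !add0r. Qed.

Lemma stateP (phi : {scalar 'M[C]_2}) :
  state phi <-> exists u, bloch phi 1 u /\ enorm u <= 1.
Proof.
split=> [[/positive_functionalP[s [u [hu us]]] p1]|[u [hu u1]]].
  have s1 : s = 1 by apply: (@complexI R); rewrite -(bloch_unit hu) p1.
  by exists u; rewrite -s1.
split; last by rewrite (bloch_unit hu).
by apply/positive_functionalP; exists 1, u.
Qed.

(** The extreme points of the unit ball are the unit vectors. *)
Lemma pure_stateP (phi : {scalar 'M[C]_2}) :
  pure_state phi <-> exists u, bloch phi 1 u /\ enorm u = 1.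
Proof.
split=> [[/stateP[u [hu u1]] pure]|[u [hu u1]]].
  exists u; split=> //; apply/eqP; rewrite eq_le u1 leNgt; apply/negP => un.
  (* If |u| < 1, the vectors u + d and u - d stay in the ball and have midpoint u, with d
     nonzero. *)
  pose d : 'cV[R]_3 := (1 - enorm u) *: delta_mx 0 0.
  have dn : enorm d = 1 - enorm u.
    by rewrite enormZ enorm_delta mulr1 ger0_norm // subr_ge0.
  have st (b : R) : `|b| = 1 -> state (bloch_functional 1 (u + b *: d)).
    move=> b1; apply/stateP; exists (u + b *: d).
    split; first exact: bloch_functionalE.
    apply: le_trans (enormD _ _) _; rewrite enormZ b1 mul1r dn.
    by rewrite addrCA subrr addr0.
  have half : 0 < (2^-1 : R) < 1.
    by rewrite invr_gt0 ltr0n /= invf_lt1 ?ltr0n // ltr1n.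
  have [] := pure _ _ _ (st 1 _) (st (-1) _) half; rewrite ?normrN ?normr1 //.
    move=> x; have [a [w ->]] := pauli_decomp x; rewrite hu.
    rewrite /= !bloch_functionalE !(map_mxD, map_mxZ, dotvDl, dotvZl).
    rewrite (_ : 1 - 2^-1 = 2^-1 :> R); last by field.
    by rewrite fmorphV rmorph_nat rmorphN !rmorph1; field.
  move=> e _; have ud := bloch_functionalE 1 (u + 1 *: d).
  have [_ /eqP] := bloch_inj (fun a w => etrans (esym (e _)) (ud a w)) hu.
  rewrite addrC -subr_eq0 addrK scale1r => /eqP d0.
  by move: dn; rewrite d0 -(scale0r 0) enormZ normr0 mul0r; lra.
split=> [|psi1 psi2 t /stateP[v1 [h1 n1]] /stateP[v2 [h2 n2]] /andP[t0 t1] e].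
  by apply/stateP; exists u; rewrite u1.
have uE : u = t *: v1 + (1 - t) *: v2.
  have hb : bloch phi 1 (t *: v1 + (1 - t) *: v2).
    move=> a w; rewrite e h1 h2 map_mxD !map_mxZ dotvDl !dotvZl.
    by rewrite rmorphB rmorph1 /=; ring.
  by have [] := bloch_inj hu hb.
have uu : dotv u u = 1 by rewrite -sqr_enorm u1 expr1n.
have d1 := dotv_le u v1; have d2 := dotv_le u v2; rewrite u1 !mul1r in d1 d2.
(* Equality case of Cauchy-Schwarz: |v - u|^2 = |v|^2 - 2 + 1 <= 0. *)
have eq_unit v : enorm v <= 1 -> dotv u v = 1 -> v = u.
  move=> v1' uv; apply/eqP; rewrite -subr_eq0; apply/eqP/enorm0_eq0.
  have := sqr_enorm (v + -1 *: u); rewrite !dotvDl !dotvDr !dotvZl !dotvZr.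
  rewrite (dotvC v u) uv uu scaleN1r -sqr_enorm.
  have := enorm_ge0 v; have := enorm_ge0 (v - u); nra.
have : t * dotv u v1 + (1 - t) * dotv u v2 = 1.
  by rewrite -!dotvZr -dotvDr -uE.
(* A convex combination, with 0 < t < 1, of two numbers at most 1 equals 1 only if both do. *)
move=> ee; have uv1 : dotv u v1 = 1 by nra.
have uv2 : dotv u v2 = 1 by nra.
rewrite (eq_unit _ n1 uv1) in h1; rewrite (eq_unit _ n2 uv2) in h2.
by split; apply: bloch_eq; eassumption.
Qed.

End Pauli.

(** * The operator [Delta] attached to [B] *)

Section Main.
Variables (R : realType) (B : 'M[R]_3).
Variable Delta : {linear 'M[R[i]]_2 -> 'M[R[i]]_(2 * 2)}.
Local Notation toC := (map_mx (real_complex R)).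
Hypothesis DeltaE : forall (w0 : R[i]) (w : 'cV[R[i]]_3),
  let Bw := toC B *m w in
  Delta (w0 *: 1%:M + dot_sigma w) =
    w0 *: (1%:M *t 1%:M) + dot_sigma Bw *t 1%:M + 1%:M *t dot_sigma Bw.
Let contractive := forall v, enorm (B *m v) <= 2^-1 * enorm v.

(** Each of the two Pauli terms of [Delta] contributes s <u, B w>, the factor s being the value of
    [phi] at 1 on the other leg. *)
Lemma quad_functional_bloch (phi : {scalar 'M[R[i]]_2}) s u :
  bloch phi s u ->
  bloch (quad_functional Delta phi) (s ^+ 2) ((2 * s) *: (B^T *m u)).
Proof.
move=> hu a w; rewrite /quad_functional /= DeltaE /=.
rewrite [LHS]linearD [X in X + _]linearD linearZ /= !tens_functionalE.
rewrite (bloch_unit hu) (bloch_sigma _ hu) map_mxZ map_mxM -map_trmx.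
by rewrite dotvZl dotv_mulmx rmorphXn rmorphM rmorph_nat; ring.
Qed.

Lemma positive_map_contractive : positive_map Delta -> contractive.
Proof.
(* The sign makes the spinor of f an eigenvector of (B w) sigma for - |B w|. *)
move=> pos w; pose f := -1 *: (B *m w).
have psdx : psdmx ((enorm w)%:C%C *: 1%:M + dot_sigma (toC w)).
  by apply/psdmx_pauli; exists (enorm w), w.
have [v vE] := spinor_trace f.
pose vv : 'cV[R[i]]_(2 * 2) := v *t v.
have vvE : vv *m adjmx vv = (v *m adjmx v) *t (v *m adjmx v).
  by rewrite -tensmx_mul -adjmx_tens.
have /psdmxE/(_ vv) := pos _ psdx.
have v1 : \tr (1%:M *m (v *m adjmx v)) = (enorm f)%:C%C.
  have := vE 1 0; rewrite scale1r dot_sigma0 addr0 => ->.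
  by rewrite -(scale0r 0) dotvZr mul0r addr0 mulr1.
have vs u : \tr (dot_sigma u *m (v *m adjmx v)) = dotv (toC f) u.
  by have := vE 0 u; rewrite scale0r add0r mulr0 add0r.
rewrite vvE DeltaE !mulmxDl -scalemxAl !tensmx_mul.
rewrite !mxtraceD mxtraceZ !mxtrace_tens !v1 !vs -map_mxM dotv_toC.
have -> : dotv f (B *m w) = - enorm f ^+ 2.
  by rewrite sqr_enorm {3}/f dotvZr mulN1r opprK.
have -> : enorm (B *m w) = enorm f by rewrite enormZ normrN1 mul1r.
rewrite -!rmorphM -!rmorphD ler0c.
(* The spinor has squared norm |f|, so the tested value is |f|^2 (|w| - 2 |f|), which says nothing
   when f = 0. *)
have [->|f0] := eqVneq (enorm f) 0.
  by move=> _; rewrite mulr_ge0 ?invr_ge0 ?enorm_ge0.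
have fp : 0 < enorm f by rewrite lt_def f0 enorm_ge0.
move=> h; rewrite -subr_ge0 -(pmulr_rge0 _ (mulr_gt0 fp fp)); lra.
Qed.

Lemma contractive_positive_map : contractive -> positive_map Delta.
Proof.
move=> h x; have [a [w ->]] := pauli_decomp x => /psdmx_pauli[s [u [-> -> us]]].
pose P : 'M[R[i]]_2 := (s / 2)%:C%C *: 1%:M + dot_sigma (toC (B *m u)).
have psdP : psdmx P.
  apply/psdmx_pauli; exists (s / 2), (B *m u); split=> //.
  by apply: le_trans (h u) _; rewrite mulrC ler_pM2r ?invr_gt0.
have -> : Delta (s%:C%C *: 1%:M + dot_sigma (toC u)) = P *t 1%:M + 1%:M *t P.
  (* Only bilinearity of the tensor product matters here, so the Pauli part becomes an arbitrary
     matrix [D] and entries are compared. *)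
  rewrite DeltaE -map_mxM; move: (dot_sigma _) @P psdP => D P _.
  apply/matrixP => i j.
  case: (mxtens_indexP i) (mxtens_indexP j) => i1 i2 [j1 j2].
  rewrite !mxE !mxtens_indexK /=.
  by rewrite [in LHS](splitr s) rmorphD; ring.
have psd1 := @psdmx1 R.
by apply: psdmxD; [exact: psdmx_tens psdP psd1 | exact: psdmx_tens psd1 psdP].
Qed.

Lemma contractive_quasi_qqo : contractive -> quasi_qqo Delta.
Proof.
move=> h; split.
- have := DeltaE 1 0; rewrite /= mulmx0 !dot_sigma0 tens0mx tensmx0.
  by rewrite !addr0 !scale1r.
- move=> x; have [a [w ->]] := pauli_decomp x.
  rewrite adjmx_pauli !DeltaE !adjmxD adjmxZ !adjmx_tens !adjmx1.
  have adj_sigma (u : 'cV[R[i]]_3) :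
      adjmx (dot_sigma u) = dot_sigma (map_mx Num.conj u).
    by have := adjmx_pauli 0 u; rewrite rmorph0 !scale0r !add0r.
  rewrite !adj_sigma map_mxM -[map_mx Num.conj (toC B)]map_mx_comp.
  (* [Delta] preserves adjoints because [B] is real and the Pauli matrices are self-adjoint. *)
  have -> : map_mx (Num.conj \o real_complex R) B = toC B.
    by apply/matrixP => i j; rewrite !mxE /= conj_toC.
  by [].
move=> phi /positive_functionalP[s [u [hu us]]].
apply/positive_functionalP; exists (s ^+ 2), ((2 * s) *: (B^T *m u)).
split; first exact: quad_functional_bloch.
(* The image stays in the cone: 2 s |B^T u| <= s |u| <= s^2. *)
have h2 : (0 : R) <= 2^-1 by rewrite invr_ge0 ler0n.
have := contraction_trmx h2 h u; rewrite enormZ.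
have s0 : 0 <= s := le_trans (enorm_ge0 u) us.
by rewrite ger0_norm ?mulr_ge0 //; have := enorm_ge0 u; nra.
Qed.

Lemma quasi_qqo_contractive : quasi_qqo Delta -> contractive.
Proof.
move=> [_ _ pos]; have h2 : (0 : R) <= 2^-1 by rewrite invr_ge0 ler0n.
move=> v; rewrite -{1}[B]trmxK; apply: contraction_trmx => // u.
(* A functional on the boundary of the cone, s = |u|, is the sharpest test: its image gives 2 |u|
   |B^T u| <= |u|^2. *)
have hu := bloch_functionalE (enorm u) u.
have /pos/positive_functionalP[t [w [hw]]] :
    positive_functional (bloch_functional (enorm u) u).
  by apply/positive_functionalP; exists (enorm u), u.
have [-> ->] := bloch_inj hw (quad_functional_bloch hu).
have u0 := enorm_ge0 u; rewrite enormZ ger0_norm ?mulr_ge0 //.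
have [/enorm0_eq0-> _|un] := eqVneq (enorm u) 0.
  by rewrite mulmx0 -(scale0r 0) enormZ normr0 mul0r mulr0.
have up : 0 < enorm u by rewrite lt_def un.
by move=> ?; rewrite -(ler_pM2l up); lra.
Qed.

Lemma q_pure_isometry : q_pure Delta <-> mx_isometry (2 *: B).
Proof.
split=> [[_ pure]|iso].
  (* Functionals see [B^T], so the claim is moved to the transpose, where homogeneity leaves only
     unit vectors. *)
  apply/mx_isometry_trmx/unit_isometry => u u1.
  have hu := bloch_functionalE 1 u.
  have /pure/pure_stateP[w [hw w1]] : pure_state (bloch_functional 1 u).
    by apply/pure_stateP; exists u.
  have [_ e] := bloch_inj hw (quad_functional_bloch hu).
  by move: w1; rewrite e mulr1 linearZ /= scalemxAl.
split.
  (* The isometry gives |B v| = |v| / 2, the equality case of the contraction bound. *)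
  apply: contractive_quasi_qqo => v.
  have := mx_isometry_norm v iso; rewrite -scalemxAl enormZ ger0_norm // => <-.
  by rewrite mulKf ?pnatr_eq0.
move=> phi /pure_stateP[u [hu u1]]; apply/pure_stateP.
exists ((2 * 1) *: (B^T *m u)); split.
  by rewrite -[X in bloch _ X](expr1n _ 2); apply: quad_functional_bloch.
have /mx_isometry_trmx/(mx_isometry_norm u) := iso.
by rewrite linearZ /= -scalemxAl u1 mulr1.
Qed.

End Main.

Theorem theorem3p5 (R : realType) (B : 'M[R]_3)
    (Delta : {linear 'M[R[i]]_2 -> 'M[R[i]]_(2 * 2)})
    (DeltaE : forall (w0 : R[i]) (w : 'cV[R[i]]_3),
      let Bw := map_mx (real_complex R) B *m w in
      Delta (w0 *: 1%:M + dot_sigma w) =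
        w0 *: (1%:M *t 1%:M) + dot_sigma Bw *t 1%:M + 1%:M *t dot_sigma Bw) :
  ((quasi_qqo Delta <-> positive_map Delta) /\
   (positive_map Delta <-> opnorm B <= 1 / 2)) /\
  ((q_pure Delta <-> mx_isometry (2 *: B)) /\
   (q_pure Delta -> positive_map Delta)).
Proof.
(* Serves both the first equivalence and the final claim, since q-purity includes being a quasi
   q.q.o. *)
have qp : quasi_qqo Delta -> positive_map Delta.
  by move=> /(quasi_qqo_contractive DeltaE); apply: contractive_positive_map.
split; split.
- split=> // /(positive_map_contractive DeltaE).
  exact: contractive_quasi_qqo.
- rewrite mul1r opnorm_le ?invr_ge0 //; split.
    exact: positive_map_contractive.
  exact: contractive_positive_map.
- exact: q_pure_isometry.
- by move=> [/qp].
Qed.
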